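(* Let $\mathcal H_1,\mathcal H_2$ be finite-dimensional complex Hilbert spaces, let $|\varphi_1\rangle,\dots,|\varphi_n\rangle\in\mathcal H_1$ and $|\phi_1\rangle,\dots,|\phi_n\rangle\in\mathcal H_2$ be unit vectors (not necessarily linearly independent), and let $\eta_1,\dots,\eta_n\in[0,1]$. Put $\Gamma=\mathrm{diag}\{\eta_1,\dots,\eta_n\}$, $\sqrt{\Gamma}=\mathrm{diag}\{\sqrt{\eta_1},\dots,\sqrt{\eta_n}\}$, and let $X,Y$ be the $n\times n$ matrices $X_{ij}=\langle\varphi_i|\varphi_j\rangle$, $Y_{ij}=\langle\phi_i|\phi_j\rangle$. Then the states $|\varphi_1\rangle,\dots,|\varphi_n\rangle$ can be transformed to the corresponding states $|\phi_1\rangle,\dots,|\phi_n\rangle$ with success probability matrix $\Gamma$ if and only if there exists an $n\times n$ positive semidefinite matrix $A$ with diagonal elements $A_{ii}=1$ for all $i$ such that $$X-\sqrt{\Gamma}\,Y\sqrt{\Gamma}^{\dagger}\circ A\ \ge\ 0 ,$$ where $\sqrt{\Gamma}\,Y\sqrt{\Gamma}^{\dagger}\circ A$ is the matrix with $(i,j)$ entry $\sqrt{\eta_i\eta_j}\,Y_{ij}A_{ij}$. Moreover, if the input states are chosen with prior probabilities $p_1,\dots,p_n\ge 0$, $\sum_i p_i=1$, then the whole success probability of such a transformation is $P=\sum_i p_i\eta_i$.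
   Context: A physically accessible operation from $\mathcal H_1$ to $\mathcal H_2$ is a completely positive trace non-increasing map $\xi$ from operators on $\mathcal H_1$ to operators on $\mathcal H_2$, i.e. $\xi(\rho)=\sum_k M_k\rho M_k^\dagger$ with $\sum_k M_k^\dagger M_k\le I$. The states $|\varphi_i\rangle$ ''can be transformed to $|\phi_i\rangle$ with success probability matrix $\Gamma=\mathrm{diag}\{\eta_1,\dots,\eta_n\}$'' means that there is a single such map $\xi$ with $\xi(|\varphi_i\rangle\langle\varphi_i|)=\eta_i|\phi_i\rangle\langle\phi_i|$ for all $i=1,\dots,n$. The success probability on an input state $\rho$ is $\mathrm{Tr}\,\xi(\rho)$, and the whole success probability for input states $\rho_i$ with priors $p_i$ is $P=\sum_i p_i\,\mathrm{Tr}\,\xi(\rho_i)$. The symbol $\circ$ denotes the Hadamard (entrywise) matrix product, and $M\ge 0$ means $M$ is Hermitian positive semidefinite. *)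

(* Defs.v *)
(* The complex numbers are R[i], with R : realType the reals. *)
From mathcomp Require Export all_boot all_order all_algebra.
From mathcomp Require Export reals.
From mathcomp Require Export complex.

Set Implicit Arguments.
Unset Strict Implicit.
Unset Printing Implicit Defensive.

Import Order.TTheory GRing.Theory Num.Theory.
Local Open Scope ring_scope.
Local Open Scope complex_scope.
Local Open Scope sesquilinear_scope.

(* The Hilbert space of dimension d is 'cV[C]_d with its standard inner product,
   conjugate-linear in the first argument; its operators are 'M[C]_d. *)
Section Hilbert.
Variable C : numClosedFieldType.

Definition braket d (u v : 'cV[C]_d) : C := (u^t* *m v) 0 0.

Definition ketbra d (u v : 'cV[C]_d) : 'M[C]_d := u *m v^t*.

(* Here [0 <= z] in C also says that z is real. *)
Definition psdmx n (A : 'M[C]_n) : Prop :=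
  A \is hermsymmx /\ forall v : 'cV[C]_n, 0 <= (v^t* *m A *m v) 0 0.

Definition hadamard n (A B : 'M[C]_n) : 'M[C]_n := map2_mx *%R A B.

Definition gram d n (phi : 'I_n -> 'cV[C]_d) : 'M[C]_n :=
  \matrix_(i, j) braket (phi i) (phi j).

(* Completely positive trace non-increasing maps, in operator-sum form. *)
Definition accessible d1 d2 (xi : 'M[C]_d1 -> 'M[C]_d2) : Prop :=
  exists (m : nat) (M : 'I_m -> 'M[C]_(d2, d1)),
    (forall rho, xi rho = \sum_k M k *m rho *m (M k)^t*) /\
    psdmx (1%:M - \sum_k (M k)^t* *m M k).

(* Only the diagonal entries of G are used. *)
Definition transforms d1 d2 n (xi : 'M[C]_d1 -> 'M[C]_d2)
    (phi : 'I_n -> 'cV[C]_d1) (psi : 'I_n -> 'cV[C]_d2) (G : 'M[C]_n) : Prop :=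
  accessible xi /\
  forall i, xi (ketbra (phi i) (phi i)) = G i i *: ketbra (psi i) (psi i).

Definition transformable d1 d2 n (phi : 'I_n -> 'cV[C]_d1)
    (psi : 'I_n -> 'cV[C]_d2) (G : 'M[C]_n) : Prop :=
  exists xi : 'M[C]_d1 -> 'M[C]_d2, transforms xi phi psi G.

Definition success_prob d1 d2 (xi : 'M[C]_d1 -> 'M[C]_d2) (rho : 'M[C]_d1) : C :=
  \tr (xi rho).

End Hilbert.

Section Probabilities.
Variable R : realType.

Definition Gamma n (eta : 'I_n -> R) : 'M[R[i]]_n := diag_mx (\row_i (eta i)%:C).

Definition sqrtGamma n (eta : 'I_n -> R) : 'M[R[i]]_n :=
  diag_mx (\row_i (Num.sqrt (eta i))%:C).

Definition whole_success_prob d1 d2 n (xi : 'M[R[i]]_d1 -> 'M[R[i]]_d2)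
    (p : 'I_n -> R) (rho : 'I_n -> 'M[R[i]]_d1) : R[i] :=
  \sum_i (p i)%:C * success_prob xi (rho i).

End Probabilities.

(* Main.v *)
(* Forward: xi maps phi_i to a multiple of the pure state psi_i, so every Kraus
   operator does too, M_k phi_i = c_ki psi_i with sum_k |c_ki|^2 = eta_i.  Take for A
   the Gram matrix of the normalized vectors (c_ki)_k; then the matrix to be shown
   positive is F^* (1 - sum_k M_k^* M_k) F, where F has columns phi_i.

   Backward: factor A = B^* B.  The Hadamard product is the Gram matrix of the
   vectors sqrt(eta_i) psi_i (x) B e_i.  By Douglas' lemma a contraction T sends phi_i
   to the i-th of them, and slicing T along the second tensor factor gives the Kraus
   operators. *)
Require Import Defs.
From mathcomp Require Import all_boot all_order all_algebra.
From mathcomp Require Import reals complex ring.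
Import Order.TTheory GRing.Theory Num.Theory.

Section PositiveMatrices.
Set Implicit Arguments.
Unset Strict Implicit.
Local Open Scope ring_scope.
Local Open Scope sesquilinear_scope.
Variable C : numClosedFieldType.

(** * Adjoints and the standard inner product *)

Lemma adjmxM m n p (A : 'M[C]_(m, n)) (B : 'M[C]_(n, p)) :
  (A *m B)^t* = B^t* *m A^t*.
Proof. by rewrite trmx_mul map_mxM. Qed.

Lemma adjmxB m n (A B : 'M[C]_(m, n)) : (A - B)^t* = A^t* - B^t*.
Proof. by apply/matrixP => i j; rewrite !mxE rmorphB. Qed.

Lemma adjmx1 n : (1%:M : 'M[C]_n)^t* = 1%:M.
Proof. by rewrite trmx1 map_mx1. Qed.

Lemma hermsymmxP n (A : 'M[C]_n) : reflect (A^t* = A) (A \is hermsymmx).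
Proof.
by apply: (iffP (is_hermitianmxP _ _ _)); rewrite expr0 scale1r => /esym.
Qed.

Lemma adjmx_mulE m n p (A : 'M[C]_(m, n)) (B : 'M[C]_(m, p)) i j :
  (A^t* *m B) i j = \sum_k (A k i)^* * B k j.
Proof. by rewrite mxE; apply: eq_bigr => k _; rewrite !mxE. Qed.

Lemma braketE d (u v : 'cV[C]_d) : braket u v = \sum_k (u k 0)^* * v k 0.
Proof. exact: adjmx_mulE. Qed.

Lemma adjmx_mul_braket m n p (A : 'M[C]_(m, n)) (B : 'M[C]_(m, p)) i j :
  (A^t* *m B) i j = braket (col i A) (col j B).
Proof.
by rewrite adjmx_mulE braketE; apply: eq_bigr => k _; rewrite !mxE.
Qed.

Lemma braket_ge0 d (u : 'cV[C]_d) : 0 <= braket u u.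
Proof. by rewrite braketE sumr_ge0 // => k _; rewrite mulrC mul_conjC_ge0. Qed.

Lemma braket_eq0 d (u : 'cV[C]_d) : braket u u = 0 -> u = 0.
Proof.
rewrite braketE => /eqP; rewrite psumr_eq0; last first.
  by move=> k _; rewrite mulrC mul_conjC_ge0.
move=> /allP u0; apply/colP => k; rewrite mxE; apply/eqP.
by have := u0 k (mem_index_enum k); rewrite /= mulrC mul_conjC_eq0.
Qed.

Lemma mxtrace_ketbra d (u v : 'cV[C]_d) : \tr (ketbra u v) = braket v u.
Proof. by rewrite /ketbra mxtrace_mulC trace_mx11. Qed.

Lemma braket_conj d (u v : 'cV[C]_d) : (braket u v)^* = braket v u.
Proof.
rewrite !braketE rmorph_sum; apply: eq_bigr => k _.
by rewrite rmorphM /= conjCK mulrC.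
Qed.

(** * Positive semidefinite matrices, their factorization, and contractions *)

Lemma psdmx_conj m n (A : 'M[C]_m) (B : 'M[C]_(m, n)) :
  psdmx A -> psdmx (B^t* *m A *m B).
Proof.
case=> /hermsymmxP hA pA; split.
  by apply/hermsymmxP; rewrite !adjmxM trmxCK hA mulmxA.
by move=> v; have := pA (B *m v); rewrite adjmxM !mulmxA.
Qed.

Lemma psdmx1 n : psdmx (1%:M : 'M[C]_n).
Proof.
split; first by apply/hermsymmxP; exact: adjmx1.
by move=> v; rewrite mulmx1; exact: braket_ge0.
Qed.

Lemma psdmx_adjM m n (B : 'M[C]_(m, n)) : psdmx (B^t* *m B).
Proof. by have := psdmx_conj B (@psdmx1 m); rewrite mulmx1. Qed.

Lemma psdmxD n (A B : 'M[C]_n) : psdmx A -> psdmx B -> psdmx (A + B).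
Proof.
move=> [/hermsymmxP hA pA] [/hermsymmxP hB pB]; split.
  by apply/hermsymmxP; rewrite raddfD map_mxD /= hA hB.
by move=> v; rewrite mulmxDr mulmxDl mxE addr_ge0.
Qed.

Lemma psdmx_entry n (A : 'M[C]_n) i : psdmx A -> 0 <= A i i.
Proof.
case=> _ /(_ (delta_mx i 0)); rewrite trmx_delta map_delta_mx.
by rewrite -rowE -colE !mxE.
Qed.

(** By the spectral theorem A = P^* diag(s) P with P unitary. The eigenvalues are diagonal entries
    of the positive matrix P A P^*, hence nonnegative, and B = diag(sqrt s) P. *)
Lemma psdmx_factor n (A : 'M[C]_n) :
  psdmx A -> exists B : 'M[C]_n, A = B^t* *m B.
Proof.
move=> psdA; have hA := psdA.1.
have /orthomx_spectralP := hermitian_normalmx hA.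
set P := spectralmx A; set s := spectral_diag A => AE.
have PU : P \is unitarymx := spectral_unitarymx A.
rewrite (invmx_unitary PU) in AE.
have sE : diag_mx s = P *m A *m P^t*.
  rewrite AE !mulmxA (unitarymxP PU) mul1mx -mulmxA (unitarymxP PU).
  by rewrite mulmx1.
have s_ge0 i : 0 <= s 0 i.
  have := psdmx_entry i (psdmx_conj (P^t*) psdA).
  by rewrite trmxCK -sE mxE eqxx.
pose r := diag_mx (\row_i sqrtC (s 0 i)).
exists (r *m P); rewrite adjmxM !mulmxA -[_ *m r]mulmxA {1}AE.
congr (_ *m _ *m _); rewrite tr_diag_mx map_diag_mx mulmx_diag.
congr diag_mx; apply/rowP => i; rewrite !mxE.
by rewrite /= conj_Creal ?ger0_real ?sqrtC_ge0 // -expr2 sqrtCK.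
Qed.

(** [S] acts as a generalized inverse of [F]. As [proj_ortho] projects onto row spaces, it is
    applied to the adjoint of [F]. *)
Lemma ortho_projector m n (F : 'M[C]_(m, n)) :
  exists2 S : 'M[C]_(n, m), (F *m S)^t* = F *m S & F *m S *m F = F /\
    (F *m S) *m (F *m S) = F *m S.
Proof.
pose P := proj_ortho (F^t*).
have hP : P^t* = P.
  (* The ranges of P and 1 - P are orthogonal, so P = P P^*, which is Hermitian. *)
  have : P *m (1%:M - P)^t* = 0.
    apply/orthomx1P; rewrite (submx_trans (_ : (P <= F^t*)%MS)) //.
      by rewrite -[P]mul1mx proj_ortho_sub.
    rewrite orthomx_sym; have := proj_ortho_compl_sub (F^t*) (1%:M : 'M[C]_m).
    by rewrite mul1mx.
  rewrite adjmxB adjmx1 mulmxBr mulmx1 => /eqP; rewrite subr_eq0 => /eqP PE.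
  by rewrite {2}PE [in LHS]PE adjmxM trmxCK.
have /submxP[Z PE] : (P <= F^t*)%MS by rewrite -[P]mul1mx proj_ortho_sub.
exists (Z^t*); have FZ : F *m Z^t* = P by rewrite -hP PE adjmxM trmxCK.
  by rewrite FZ.
rewrite FZ; split; last exact: proj_ortho_proj.
by rewrite -hP -[in LHS](trmxCK F) -adjmxM proj_ortho_id ?trmxCK.
Qed.

(* Douglas' lemma: with F S the orthogonal projector onto the column space of F,
   T = W S works. *)
Lemma contraction_factor d m n (F : 'M[C]_(d, n)) (W : 'M[C]_(m, n)) :
  psdmx (F^t* *m F - W^t* *m W) ->
  exists2 T : 'M[C]_(m, d), T *m F = W & psdmx (1%:M - T^t* *m T).
Proof.
move=> FW; have [S hP [PF PP]] := ortho_projector F.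
exists (W *m S).
  (* F E = 0, so compressing the hypothesis by E leaves - (W E)^* (W E) positive semidefinite. Its
     diagonal then forces every column of W E to vanish. *)
  pose E := S *m F - 1%:M.
  have FE : F *m E = 0 by rewrite mulmxBr mulmx1 mulmxA PF subrr.
  suff : W *m E = 0.
    by rewrite mulmxBr mulmx1 mulmxA => /eqP; rewrite subr_eq0 => /eqP.
  have /(fun h j => psdmx_entry j h) WE := psdmx_conj E FW.
  apply/matrixP => i j; rewrite mxE.
  have := WE j; rewrite -mulmxA mulmxBl -!mulmxA FE !mulmx0 sub0r mulmxN.
  rewrite mulmxA -adjmxM mxE oppr_ge0 adjmx_mul_braket => WE_le0.
  have /braket_eq0/colP/(_ i) : braket (col j (W *m E)) (col j (W *m E)) = 0.
    by apply/eqP; rewrite eq_le WE_le0 braket_ge0.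
  by rewrite !mxE.
(* Since 1 - F S is a projector and S^* F^* F S = F S, the terms without W add up to 1. *)
have -> : 1%:M - (W *m S)^t* *m (W *m S) =
    (1%:M - F *m S)^t* *m (1%:M - F *m S)
    + S^t* *m (F^t* *m F - W^t* *m W) *m S.
  have SFS : S^t* *m (F^t* *m F) *m S = F *m S.
    by rewrite -[RHS]PP -{1}hP adjmxM !mulmxA.
  rewrite [X in _ = _ + X *m _]mulmxBr [X in _ = _ + X]mulmxBl SFS adjmxB adjmx1 hP mulmxBl.
  by rewrite mul1mx mulmxBr mulmx1 PP subrr subr0 addrA subrK adjmxM !mulmxA.
by apply: psdmxD; [exact: psdmx_adjM|exact: psdmx_conj].
Qed.

(** * Gram matrices, sesquilinear calculus and pure states *)

Lemma gram_adjM d n (phi : 'I_n -> 'cV[C]_d) (F := \matrix_(k, i) phi i k 0) :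
  (forall i, col i F = phi i) /\ gram phi = F^t* *m F.
Proof.
have colF i : col i F = phi i by apply/colP => k; rewrite !mxE.
by split=> //; apply/matrixP => i j; rewrite adjmx_mul_braket !colF mxE.
Qed.

Lemma braketBr d (u v w : 'cV[C]_d) : braket u (v - w) = braket u v - braket u w.
Proof. by rewrite /braket mulmxBr !mxE. Qed.

Lemma braketZr d a (u v : 'cV[C]_d) : braket u (a *: v) = a * braket u v.
Proof. by rewrite /braket -scalemxAr mxE. Qed.

Lemma braketBl d (u v w : 'cV[C]_d) : braket (u - v) w = braket u w - braket v w.
Proof. by rewrite -braket_conj braketBr rmorphB /= !braket_conj. Qed.

Lemma braketZl d a (u v : 'cV[C]_d) : braket (a *: u) v = a^* * braket u v.
Proof. by rewrite -braket_conj braketZr rmorphM /= braket_conj. Qed.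

Lemma braket0 d (u : 'cV[C]_d) : braket u 0 = 0.
Proof. by rewrite /braket mulmx0 mxE. Qed.

Lemma braket_sumr d m (u : 'cV[C]_d) (v : 'I_m -> 'cV[C]_d) :
  braket u (\sum_k v k) = \sum_k braket u (v k).
Proof. by rewrite /braket mulmx_sumr summxE. Qed.

Lemma braket_adj d1 d2 (M : 'M[C]_(d2, d1)) u v :
  braket u (M^t* *m v) = braket (M *m u) v.
Proof. by rewrite /braket adjmxM mulmxA. Qed.

Lemma braket_col_mx d1 d2 (u1 v1 : 'cV[C]_d1) (u2 v2 : 'cV[C]_d2) :
  braket (col_mx u1 u2) (col_mx v1 v2) = braket u1 v1 + braket u2 v2.
Proof. by rewrite /braket tr_col_mx map_row_mx mul_row_col mxE. Qed.

Lemma mulmx_ketbra d1 d2 (M : 'M[C]_(d2, d1)) u v :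
  M *m ketbra u v *m M^t* = ketbra (M *m u) (M *m v).
Proof. by rewrite /ketbra adjmxM !mulmxA. Qed.

Lemma ketbraZ d a (u : 'cV[C]_d) :
  ketbra (a *: u) (a *: u) = (a^* * a) *: ketbra u u.
Proof.
by apply/matrixP => i j; rewrite !(mxE, big_ord1) rmorphM /= mulrACA (mulrC a).
Qed.

Lemma sandwich_ketbra d (u v w : 'cV[C]_d) :
  (w^t* *m ketbra u v *m w) 0 0 = braket w u * braket v w.
Proof. by rewrite /ketbra mulmxA -[_ *m w]mulmxA mxE big_ord1. Qed.

(** Evaluating the hypothesis at [psi] and taking its trace both give e. The difference is the sum
    of the squared norms of the components of the [u k] orthogonal to [psi], so all of these vanish.
    Applied to u_k = M_k phi_i, it shows that each Kraus operator preserves purity. *)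
Lemma sum_ketbra_pure d m (u : 'I_m -> 'cV[C]_d) (psi : 'cV[C]_d) e :
    braket psi psi = 1 ->
    \sum_k ketbra (u k) (u k) = e *: ketbra psi psi ->
  (forall k, u k = braket psi (u k) *: psi) /\
  \sum_k (braket psi (u k))^* * braket psi (u k) = e.
Proof.
move=> psi1 uE.
have sum_e : \sum_k (braket psi (u k))^* * braket psi (u k) = e.
  have := congr1 (fun X => (psi^t* *m X *m psi) 0 0) uE.
  rewrite -scalemxAr -scalemxAl [X in _ = X]mxE sandwich_ketbra psi1 !mulr1 => <-.
  rewrite mulmx_sumr mulmx_suml summxE; apply: eq_bigr => k _.
  by rewrite sandwich_ketbra braket_conj mulrC.
split=> // k; apply/eqP; rewrite -subr_eq0; apply/eqP/braket_eq0.
have resE j : braket (u j - braket psi (u j) *: psi) (u j - braket psi (u j) *: psi)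
    = braket (u j) (u j) - (braket psi (u j))^* * braket psi (u j).
  rewrite braketBl !braketBr !braketZl !braketZr psi1 mulr1 braket_conj.
  by rewrite -(braket_conj (u j)); ring.
have : \sum_j braket (u j - braket psi (u j) *: psi)
                     (u j - braket psi (u j) *: psi) = 0.
  under eq_bigr do rewrite resE.
  rewrite sumrB sum_e; have := congr1 mxtrace uE.
  rewrite linear_sum linearZ /= mxtrace_ketbra psi1 mulr1 => <-.
  by apply/eqP; rewrite subr_eq0; apply/eqP/eq_bigr => j _; rewrite mxtrace_ketbra.
by move/psumr_eq0P => -> // j _; exact: braket_ge0.
Qed.

Lemma sum_mxvec_index (V : nmodType) m n (f : 'I_(m * n) -> V) :
  \sum_r f r = \sum_i \sum_j f (mxvec_index i j).
Proof.
rewrite pair_bigA (reindex _ (curry_mxvec_bij m n)) /=.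
by apply: eq_bigr => -[].
Qed.

(** * The two directions of the equivalence *)

Section Transformation.
Variables (d1 d2 n : nat) (phi : 'I_n -> 'cV[C]_d1) (psi : 'I_n -> 'cV[C]_d2).
(** The weight [s i] stands for the square root of eta_i; with success probabilities written
    [s i ^+ 2], the section works over any [numClosedFieldType]. *)
Variable s : 'I_n -> C.
Hypothesis psi1 : forall i, braket (psi i) (psi i) = 1.
Hypothesis s_ge0 : forall i, 0 <= s i.

Let conj_s i : (s i)^* = s i.
Proof. by rewrite conj_Creal ?ger0_real. Qed.

Lemma weighted_gramE (A : 'M[C]_n) i j :
  hadamard (diag_mx (\row_i s i) *m gram psi *m (diag_mx (\row_i s i))^t*) A i j
  = s i * s j * A i j * braket (psi i) (psi j).
Proof.
rewrite tr_diag_mx map_diag_mx mul_diag_mx mul_mx_diag !mxE /= conj_s; ring.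
Qed.

Lemma transformable_weights :
    transformable phi psi (diag_mx (\row_i s i ^+ 2)) ->
  exists A : 'M[C]_n, psdmx A /\ (forall i, A i i = 1) /\
    psdmx (gram phi -
      hadamard (diag_mx (\row_i s i) *m gram psi *m (diag_mx (\row_i s i))^t*) A).
Proof.
case=> xi [[m [M [xiE psdM]]] xi_phi].
pose c k i := braket (psi i) (M k *m phi i).
have Mphi i : (forall k, M k *m phi i = c k i *: psi i) /\
    \sum_k (c k i)^* * c k i = s i ^+ 2.
  apply: sum_ketbra_pure => //; have := xi_phi i.
  by rewrite xiE !mxE eqxx => <-; apply: eq_bigr => k _; rewrite mulmx_ketbra.
(* The last coordinate keeps a i a unit vector when s i = 0, where c k i / s i = 0. *)
pose a i : 'cV[C]_(m + 1) :=
  col_mx (\col_k (c k i / s i)) (const_mx (s i == 0)%:R).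
have sa i : s i *: a i = col_mx (\col_k c k i) 0.
  rewrite /a scale_col_mx; congr col_mx; apply/colP => k; rewrite !mxE.
    have [s0|s_neq0] := eqVneq (s i) 0; last by rewrite mulrC divfK.
    (* Here the squared moduli of the [c k i] sum to 0, so [c k i] itself is 0. *)
    have [_] := Mphi i; rewrite s0 expr0n mul0r => /psumr_eq0P cE.
    apply/esym/eqP; rewrite -mul_conjC_eq0 mulrC cE // => j _.
    by rewrite mulrC mul_conjC_ge0.
  by case: eqVneq => [->|_]; rewrite ?mul0r ?mulr0.
(* Keeping the factors [s i * s j] makes this hold for vanishing weights too: the padding coordinate
   is multiplied by 0. *)
have ssA i j : s i * s j * gram a i j = \sum_k (c k i)^* * c k j.
  rewrite mxE -{1}conj_s -mulrA -braketZr -braketZl !sa braket_col_mx braket0.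
  by rewrite addr0 braketE; apply: eq_bigr => k _; rewrite !mxE.
exists (gram a); split; first by rewrite (gram_adjM a).2; exact: psdmx_adjM.
split=> [i|].
  have [s0|s_neq0] := eqVneq (s i) 0.
    rewrite mxE braket_col_mx !braketE big1 ?add0r => [|k _]; last first.
      by rewrite !mxE s0 invr0 !mulr0.
    by rewrite big_ord1 mxE s0 eqxx conjC1 mulr1.
  have := ssA i i; rewrite (Mphi i).2 -expr2 => /(canRL (mulKf _)) ->.
    by rewrite mulVf // expf_neq0.
  by rewrite expf_neq0.
have [colF _] := gram_adjM phi; set F := \matrix_(k, i) _ in colF.
(* By [ssA] and M_k phi_i = c_ki psi_i, the Hadamard term has entries equal to the sum over k of
   <M_k phi_i, M_k phi_j>. *)
rewrite [X in psdmx X](_ : _ = F^t* *m (1%:M - \sum_k (M k)^t* *m M k) *m F).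
  exact: psdmx_conj.
apply/matrixP => i j; rewrite [LHS]mxE [X in _ + X = _]mxE weighted_gramE ssA.
rewrite -mulmxA adjmx_mul_braket colF colE -!mulmxA -colE colF mulmxBl mul1mx braketBr.
rewrite mxE; congr (_ - _); rewrite mulmx_suml braket_sumr mulr_suml.
apply: eq_bigr => k _; rewrite -mulmxA braket_adj.
by rewrite (Mphi i).1 (Mphi j).1 braketZl braketZr mulrA.
Qed.

Lemma transformable_of_weights (A : 'M[C]_n) :
    psdmx A -> (forall i, A i i = 1) ->
    psdmx (gram phi -
      hadamard (diag_mx (\row_i s i) *m gram psi *m (diag_mx (\row_i s i))^t*) A) ->
  transformable phi psi (diag_mx (\row_i s i ^+ 2)).
Proof.
move=> /psdmx_factor[B AE] A1.
have [colF ->] := gram_adjM phi; set F := \matrix_(k, i) _ in colF *.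
(* Column i of W is the tensor product of s i *: psi i and column i of B. *)
pose W := \matrix_(r < d2 * n, i < n)
  mxvec (\matrix_(x, y) (s i * psi i x 0 * B y i)) 0 r.
have WE x y i : W (mxvec_index x y) i = s i * psi i x 0 * B y i.
  by rewrite mxE mxvecE mxE.
have -> : hadamard (diag_mx (\row_i s i) *m gram psi *m (diag_mx (\row_i s i))^t*) A
    = W^t* *m W.
  apply/matrixP => i j; rewrite weighted_gramE adjmx_mulE sum_mxvec_index.
  rewrite AE adjmx_mulE braketE mulr_sumr; apply: eq_bigr => x _.
  rewrite mulrAC mulr_sumr; apply: eq_bigr => y _.
  by rewrite !WE !rmorphM /= conj_s; ring.
case/contraction_factor => T TF psdT.
(* [T] stacks the blocks [M k], so the sum of the M_k^* M_k is T^* T and the contraction bound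
   carries over. *)
pose M k := \matrix_(x, y) T (mxvec_index x k) y.
have Mphi k i : M k *m phi i = (s i * B k i) *: psi i.
  apply/colP => x; rewrite [RHS]mxE mulrAC -WE -TF !mxE.
  by apply: eq_bigr => y _; rewrite !mxE.
exists (fun rho => \sum_k M k *m rho *m (M k)^t*); split.
  exists n, M; split=> //; suff -> : \sum_k (M k)^t* *m M k = T^t* *m T by [].
  apply/matrixP => i j; rewrite adjmx_mulE sum_mxvec_index exchange_big summxE.
  apply: eq_bigr => k _; rewrite adjmx_mulE.
  by apply: eq_bigr => x _; rewrite !mxE.
(* The output weight is s_i^2 times the squared norm of column i of B, which is A_ii = 1. *)
move=> i; rewrite !mxE eqxx -[_ *+ _]mulr1 -(A1 i) AE adjmx_mulE.
rewrite mulr_sumr scaler_suml; apply: eq_bigr => k _.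
by rewrite mulmx_ketbra Mphi ketbraZ rmorphM /= conj_s; congr (_ *: _); ring.
Qed.

End Transformation.
End PositiveMatrices.

Local Open Scope ring_scope.
Local Open Scope complex_scope.
Local Open Scope sesquilinear_scope.

Theorem lemma1 (R : realType) (d1 d2 n : nat)
    (phi : 'I_n -> 'cV[R[i]]_d1) (psi : 'I_n -> 'cV[R[i]]_d2)
    (eta : 'I_n -> R)
    (phi_unit : forall i, braket (phi i) (phi i) = 1)
    (psi_unit : forall i, braket (psi i) (psi i) = 1)
    (eta01 : forall i, 0 <= eta i <= 1) :
  (transformable phi psi (Gamma eta) <->
   exists A : 'M[R[i]]_n,
     psdmx A /\ (forall i, A i i = 1) /\
     psdmx (gram phi -
            hadamard (sqrtGamma eta *m gram psi *m (sqrtGamma eta)^t*) A)) /\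
  (forall p : 'I_n -> R, (forall i, 0 <= p i) -> \sum_i p i = 1 ->
   forall xi : 'M[R[i]]_d1 -> 'M[R[i]]_d2,
     transforms xi phi psi (Gamma eta) ->
     whole_success_prob xi p (fun i => ketbra (phi i) (phi i)) =
       (\sum_i p i * eta i)%:C).

Proof.
have s_ge0 i : 0 <= (Num.sqrt (eta i))%:C by rewrite lecR sqrtr_ge0.
(* Nonnegativity of [eta] lets it be written as the square of its root, the form used for the
   weights [s]. *)
have GE : Gamma eta = diag_mx (\row_i (Num.sqrt (eta i))%:C ^+ 2).
  congr diag_mx; apply/rowP => i; rewrite !mxE -rmorphXn /= sqr_sqrtr //.
  by case/andP: (eta01 i).
split.
  rewrite GE; split; first exact: transformable_weights.
  by case=> A [psdA [A1]]; exact: transformable_of_weights.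
move=> p _ _ xi [_ xiE]; rewrite /whole_success_prob /success_prob rmorph_sum.
apply: eq_bigr => i _; rewrite xiE linearZ /= mxtrace_ketbra psi_unit mulr1.
by rewrite !mxE eqxx mulr1n rmorphM.
Qed.
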